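(* Let $G$ be a countable group and let $X$ be a countably infinite set. Then $G$ admits a generic permutation representation (on $X$) if and only if $G$ is solitary.
   Context: $\mathrm{Sub}(G)$ is the set of all subgroups of the countable group $G$, with the Chabauty topology, i.e. the topology induced from the product topology on $\{0,1\}^G$; it is a compact metrizable space. $\mathrm{Is}(G)\subseteq \mathrm{Sub}(G)$ is the set of isolated points of $\mathrm{Sub}(G)$. $G$ is called solitary if $\mathrm{Is}(G)$ is dense in $\mathrm{Sub}(G)$. $X!$ is the group of all permutations of $X$ with the topology of pointwise convergence ($X$ discrete), a Polish group. $\mathrm{Hom}(G,X!)$, the space of permutation representations of $G$ on $X$, carries the topology of pointwise convergence (as a closed subspace of $(X!)^G$), which makes it a Polish space. $X!$ acts on $\mathrm{Hom}(G,X!)$ by $(\alpha\cdot\varphi)(g)=\alpha\varphi(g)\alpha^{-1}$. $G$ admits a generic permutation representation if there is $\tau^*\in \mathrm{Hom}(G,X!)$ whose $X!$-orbit is co-meager in $\mathrm{Hom}(G,X!)$ (i.e. contains a countable intersection of dense open sets). *)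

(* Defs.v *)
From HB Require Import structures.
From mathcomp Require Import all_boot.
From mathcomp Require Import boolp classical_sets functions cardinality.
From mathcomp Require Import topology borel_hierarchy.

Set Implicit Arguments.
Unset Strict Implicit.
Unset Printing Implicit Defensive.

Local Open Scope classical_set_scope.
Local Open Scope group_scope.

(* {0,1}^G with its product topology is {ptws G -> bool}; a subgroup is
   identified with its indicator function. *)
Definition subgroups (G : groupType) : set {ptws G -> bool} :=
  [set H | group_closed [pred x | H x]].

(* As a [set_type], [Subgrp G] carries the induced (Chabauty) topology. *)
Definition Subgrp (G : groupType) : topologicalType := set_type (@subgroups G).

Definition isolated_subgroups (G : groupType) : set (Subgrp G) :=
  isolated [set: Subgrp G].

Definition solitary (G : groupType) : Prop := dense (@isolated_subgroups G).

Definition permutations (X : choiceType) :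
  set {ptws X -> discrete_topology X} := [set f | bijective f].

Definition Perm (X : choiceType) : Type := set_type (@permutations X).

HB.instance Definition _ (X : choiceType) :=
  Topological.copy (Perm X) (set_type (@permutations X)).

Section PermGroup.
Variable X : choiceType.
Implicit Types a b c : Perm X.

Definition perm_fun a : X -> X := \val a.

Lemma perm_fun_bij a : bijective (perm_fun a).
Proof. exact: set_valP. Qed.

Lemma perm_fun_inj : injective perm_fun.
Proof. exact: val_inj. Qed.

Definition mkperm (f : X -> X) (bf : bijective f) : Perm X :=
  @SigSub _ _ _ (f : {ptws X -> discrete_topology X}) (mem_set bf).

Lemma mkpermE f bf : perm_fun (@mkperm f bf) = f.
Proof. by []. Qed.

Lemma perm_inv_ex a :
  {g : X -> X | cancel (perm_fun a) g /\ cancel g (perm_fun a)}.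
Proof. by apply: cid; have [g fK gK] := perm_fun_bij a; exists g. Qed.

Definition perm_one : Perm X :=
  mkperm (Bijective (@frefl X X id) (@frefl X X id)).

Lemma perm_inv_bij a : bijective (sval (perm_inv_ex a)).
Proof. by case: (perm_inv_ex a) => g [fK gK]; exists (perm_fun a). Qed.

Definition perm_inv a : Perm X := mkperm (perm_inv_bij a).

(* Product is composition, [(a * b) x = a (b x)], so that [X!] acts on [X]
   from the left; this is opposite to the convention of mathcomp's [perm]. *)
Definition perm_mul a b : Perm X :=
  mkperm (bij_comp (perm_fun_bij a) (perm_fun_bij b)).

Lemma perm_mulA : associative perm_mul.
Proof. by move=> a b c; apply: perm_fun_inj. Qed.

Lemma perm_mul1 : left_id perm_one perm_mul.
Proof. by move=> a; apply: perm_fun_inj. Qed.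

Lemma perm_mulr1 : right_id perm_one perm_mul.
Proof. by move=> a; apply: perm_fun_inj. Qed.

Lemma perm_mulV : left_inverse perm_one perm_inv perm_mul.
Proof.
move=> a; apply: perm_fun_inj; apply: funext => x.
by rewrite !mkpermE /=; case: perm_inv_ex => g [fK gK] /=; rewrite fK.
Qed.

Lemma perm_mulrV : right_inverse perm_one perm_inv perm_mul.
Proof.
move=> a; apply: perm_fun_inj; apply: funext => x.
by rewrite !mkpermE /=; case: perm_inv_ex => g [fK gK] /=; rewrite gK.
Qed.

HB.instance Definition _ := isGroup.Build (Perm X)
  perm_mulA perm_mul1 perm_mulr1 perm_mulV perm_mulrV.

End PermGroup.

Section PermutationRepresentations.
Variables (G : groupType) (X : choiceType).

Definition homs : set {ptws G -> Perm X} :=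
  [set phi | {morph phi : g h / g * h}].

Definition Hom : topologicalType := set_type homs.

Definition hom_fun (phi : Hom) : G -> Perm X := \val phi.

Lemma hom_funM (phi : Hom) : {morph hom_fun phi : g h / g * h}.
Proof. by move: (set_valP phi). Qed.

Lemma conj_in_homs (a : Perm X) (phi : Hom) :
  homs (fun g => a * hom_fun phi g * a^-1).
Proof. by move=> g h; rewrite hom_funM !mulgA mulgVK. Qed.

Definition conj_hom (a : Perm X) (phi : Hom) : Hom :=
  SigSub (mem_set (conj_in_homs a phi)).

Definition conj_orbit (phi : Hom) : set Hom :=
  range (fun a : Perm X => conj_hom a phi).

End PermutationRepresentations.

Definition comeager (T : topologicalType) (A : set T) : Prop :=
  exists2 S : set T, Gdelta_dense S & S `<=` A.

Definition has_generic_representation (G : groupType) (X : choiceType) : Prop :=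
  exists tau : Hom G X, comeager (conj_orbit tau).

(* Main.v *)
(* Solitary implies generic: call a representation rich if all its stabilizers
   are isolated and, for every isolated subgroup L, the orbit type G/L occurs
   exactly once when N(L)/L is infinite and infinitely often when it is finite.
   Any two rich representations are conjugate by a back-and-forth argument.
   Richness follows from countably many open dense conditions: a finite piece
   of an orbit G/H survives in G/L for L close to H, an orbit G/L can always
   be added, and two orbits of type G/L can be merged if N(L)/L is infinite.

   Generic implies solitary: if H is not isolated, then "H is not the stabilizer
   of x" is an open dense condition, so every stabilizer of the generic
   representation is isolated.  As "some point has its stabilizer in U" is open
   and nonempty for each nonempty open U, the generic representation has a
   stabilizer in U. *)
Require Import Defs.
From mathcomp Require Import all_boot.
From mathcomp Require Import boolp classical_sets functions cardinality.
From mathcomp Require Import topology borel_hierarchy.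

Local Open Scope classical_set_scope.

Section GenericRepresentations.
Set Implicit Arguments.
Unset Strict Implicit.
Unset Printing Implicit Defensive.
Local Open Scope group_scope.

(** * Topologies generated by evaluations into a discrete set *)

Lemma open_evalP (T : topologicalType) (I : choiceType) (S : Type)
    (e : I -> T -> S) :
    (forall i t, nbhs t [set s | e i s = e i t]) ->
    (forall (F : set_system T) (t : T), Filter F ->
      (forall i, F [set s | e i s = e i t]) -> F --> t) ->
  forall U : set T, open U <-> (forall t, U t ->
    exists c : seq I, forall s, {in c, forall i, e i s = e i t} -> U s).
Proof.
move=> enbhs ecvg U; split => [oU t Ut|Uc]; last first.
  rewrite openE => t /Uc[c cU]; apply: filterS cU _.
  elim: c => [|i c IHc]; first exact: filterS filterT.
  apply: filterS (filterI (enbhs i t) IHc) => s [/= eis ecs] j.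
  by rewrite inE => /predU1P[->//|/ecs].
(* [F] is generated by the finite evaluation conditions at [t]; by [ecvg] it refines the
   neighbourhood filter of [t]. *)
pose F : set_system T := [set A : set T | exists c : seq I,
  forall s, {in c, forall i, e i s = e i t} -> A s].
have FF : Filter F.
  split => [|A B [c cA] [d dB]|A B AB [c cA]].
  - by exists [::].
  - by exists (c ++ d) => s scd; split; [apply: cA|apply: dB] => i ic;
      apply: scd; rewrite mem_cat ic ?orbT.
  - by exists c => s /cA /AB.
have : F --> t.
  by apply: ecvg => i; exists [:: i] => s; apply; rewrite inE.
by move=> /(_ U); apply; exact: open_nbhs_nbhs.
Qed.

Lemma dense_evalP (T : topologicalType) (I : choiceType) (S : Type)
    (e : I -> T -> S) :
    (forall U : set T, open U <-> (forall t, U t ->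
      exists c : seq I, forall s, {in c, forall i, e i s = e i t} -> U s)) ->
  forall D : set T, dense D <-> (forall t (c : seq I),
    exists2 s, {in c, forall i, e i s = e i t} & D s).
Proof.
move=> openP D; split => [dD t c|Dc U [t Ut] /openP/(_ t Ut)[c cU]].
  pose U := [set s | {in c, forall i, e i s = e i t}].
  have [||s [Us Ds]] := dD U; [by exists t| |by exists s].
  by apply/openP => s Us; exists c => r rs i ic; rewrite rs// Us.
by have [s /cU Us Ds] := Dc t c; exists s.
Qed.

Lemma cvg_initial (S : choiceType) (T : topologicalType) (f : S -> T)
    (F : set_system S) (s : S) :
  Filter F -> f @ F --> f s -> F --> (s : initial_topology f).
Proof.
move=> FF cvfF A [_ [[B oB <-] /= Bfs] BA].
by apply: filterS BA _; apply: cvfF; apply: open_nbhs_nbhs.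
Qed.

Lemma cvg_ptws (I : Type) (T : topologicalType) (F : set_system (I -> T))
    (f : I -> T) :
  Filter F -> (forall i, (fun h : I -> T => h i) @ F --> f i) ->
  F --> (f : {ptws I -> T}).
Proof. by move=> FF cvF; apply/cvg_sup => i; apply: cvg_initial. Qed.

(** * Basic open sets of [Subgrp G] and [Hom G X] *)

Section Space.
Variables (G : groupType) (X : choiceType).

Definition mem_sub (H : Subgrp G) (g : G) : bool := (\val H : G -> bool) g.

Lemma open_SubgrpP (U : set (Subgrp G)) : open U <-> (forall H, U H ->
  exists K : seq G, forall L, {in K, mem_sub L =1 mem_sub H} -> U L).
Proof.
apply: (@open_evalP (Subgrp G) G bool (fun g H => mem_sub H g)) => [g H|F H FF FH].
  have c1 : {for H, continuous (set_val : Subgrp G -> {ptws G -> bool})}.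
    exact: initial_continuous.
  have c2 : {for (set_val H), continuous (fun f : {ptws G -> bool} => f g)}.
    exact: (@proj_continuous G (fun=> bool) g).
  have c := continuous_comp c1 c2.
  exact: (c _ (@discrete_set1 bool _)).
apply: cvg_initial; apply: cvg_ptws => g.
by apply/(@discrete_cvg bool); exact: FH.
Qed.

Definition act (phi : Hom G X) (g : G) (x : X) : X :=
  perm_fun (hom_fun phi g) x.

Lemma open_HomP (U : set (Hom G X)) : open U <-> (forall phi, U phi ->
  exists c : seq (G * X), forall psi,
    {in c, forall p, act psi p.1 p.2 = act phi p.1 p.2} -> U psi).
Proof.
apply: (@open_evalP (Hom G X) (G * X)%type X (fun p phi => act phi p.1 p.2)).
  move=> [g x] phi /=.
  have c1 : {for phi, continuous (set_val : Hom G X -> {ptws G -> Perm X})}.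
    exact: initial_continuous.
  have c2 : {for (set_val phi), continuous (fun f : {ptws G -> Perm X} => f g)}.
    exact: (@proj_continuous G (fun=> Perm X) g).
  have c3 : {for set_val phi g, continuous
      (set_val : Perm X -> {ptws X -> discrete_topology X})}.
    exact: initial_continuous.
  have c4 : {for set_val (set_val phi g), continuous
      (fun f : {ptws X -> discrete_topology X} => f x)}.
    exact: (@proj_continuous X (fun=> discrete_topology X) x).
  have c := continuous_comp (continuous_comp (continuous_comp c1 c2) c3) c4.
  exact: (c _ (@discrete_set1 (discrete_topology X) _)).
move=> F phi FF Fphi; apply: cvg_initial; apply: cvg_ptws => g.
apply: cvg_initial; apply: cvg_ptws => x.
by apply/(@discrete_cvg (discrete_topology X)); exact: (Fphi (g, x)).
Qed.

Lemma dense_SubgrpP (D : set (Subgrp G)) : dense D <-> (forall H (K : seq G),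
  exists2 L, {in K, mem_sub L =1 mem_sub H} & D L).
Proof. exact: (@dense_evalP _ G bool (fun g H => mem_sub H g) open_SubgrpP). Qed.

Lemma dense_HomP (D : set (Hom G X)) : dense D <->
  (forall phi (c : seq (G * X)), exists2 psi,
    {in c, forall p, act psi p.1 p.2 = act phi p.1 p.2} & D psi).
Proof.
exact: (@dense_evalP _ (G * X)%type X (fun p phi => act phi p.1 p.2) open_HomP).
Qed.


(** * Subgroups, actions and stabilizers *)

Lemma mem_sub_closed (H : Subgrp G) : group_closed [pred g | mem_sub H g].
Proof. exact: (set_valP H). Qed.

Lemma mem_sub1 (H : Subgrp G) : mem_sub H 1.
Proof. by case: (mem_sub_closed H). Qed.

Lemma mem_subV (H : Subgrp G) g : mem_sub H g -> mem_sub H g^-1.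
Proof. exact: (group_closedV (mem_sub_closed H)). Qed.

Lemma mem_subM (H : Subgrp G) g h :
  mem_sub H g -> mem_sub H h -> mem_sub H (g * h).
Proof. exact: (group_closedM (mem_sub_closed H)). Qed.

Lemma Subgrp_ext (H L : Subgrp G) : mem_sub H =1 mem_sub L -> H = L.
Proof. by move=> HL; apply: val_inj; apply: funext. Qed.

Lemma isolatedP (H : Subgrp G) : isolated_subgroups H <->
  exists K : seq G, forall L, {in K, mem_sub L =1 mem_sub H} -> L = H.
Proof.
split=> [[_ [V]]|[K KH]].
  rewrite nbhsE setIT => -[U [oU UH] UV] VH.
  have [K KU] := (open_SubgrpP U).1 oU H UH.
  by exists K => L /KU /UV; rewrite VH.
split; first exact: in_setT.
exists [set H]; last by rewrite setIT.
apply: open_nbhs_nbhs; split=> //; apply/open_SubgrpP => L -> /=.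
by exists K.
Qed.

(** Multiplicativity makes [phi 1] idempotent, and an idempotent permutation is the identity. *)
Lemma act1 phi x : act phi 1 x = x.
Proof.
apply: (bij_inj (perm_fun_bij (hom_fun phi 1))).
by have := hom_funM phi 1 1; rewrite mulg1 => /(congr1 (fun p => perm_fun p x)).
Qed.

Lemma actM phi g h x : act phi (g * h) x = act phi g (act phi h x).
Proof. by rewrite /act hom_funM. Qed.

Lemma actK phi g : cancel (act phi g) (act phi g^-1).
Proof. by move=> x; rewrite -actM mulVg act1. Qed.

Lemma actKV phi g : cancel (act phi g^-1) (act phi g).
Proof. by move=> x; rewrite -actM mulgV act1. Qed.

Lemma act_inj phi g : injective (act phi g).
Proof. exact: can_inj (actK phi g). Qed.

Lemma Hom_ext phi psi : act phi =2 act psi -> phi = psi.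
Proof.
move=> phipsi; apply: val_inj; apply: funext => g.
by apply: perm_fun_inj; apply: funext => x; exact: phipsi.
Qed.

Lemma Hom_of_action (f : G -> X -> X) :
  (forall x, f 1 x = x) -> (forall g h x, f (g * h) x = f g (f h x)) ->
  exists phi, act phi = f.
Proof.
move=> f1 fM.
have bf g : bijective (f g).
  by exists (f g^-1) => x; rewrite -fM ?mulVg ?mulgV f1.
have fhom : homs (fun g => mkperm (bf g)).
  by move=> g h; apply: perm_fun_inj; apply: funext => x; exact: fM.
by exists (SigSub (mem_set fhom)).
Qed.

Lemma act_conj_hom a phi g x :
  act (conj_hom a phi) g (perm_fun a x) = perm_fun a (act phi g x).
Proof.
transitivity (perm_fun (a * hom_fun phi g * a^-1 * a) x) => //.
by rewrite mulgVK.
Qed.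

Lemma conj_homP a phi psi :
  (forall g x, act psi g (perm_fun a x) = perm_fun a (act phi g x)) ->
  conj_hom a phi = psi.
Proof.
move=> apsi; apply: Hom_ext => g y.
have [b ab ba] := perm_fun_bij a.
by rewrite -(ba y) act_conj_hom apsi.
Qed.

Lemma stab_closed phi x : subgroups (fun g => act phi g x == x).
Proof.
split; first by rewrite inE act1.
move=> g h; rewrite !inE => /eqP gx /eqP hx.
by apply/eqP; rewrite actM -[in act phi h^-1 _]hx actK.
Qed.

Definition stab phi x : Subgrp G := SigSub (mem_set (@stab_closed phi x)).

Lemma mem_stab phi x g : mem_sub (stab phi x) g = (act phi g x == x).
Proof. by []. Qed.

Lemma stab_conj_hom a phi x :
  stab (conj_hom a phi) (perm_fun a x) = stab phi x.
Proof.
apply: Subgrp_ext => g; rewrite !mem_stab act_conj_hom.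
by rewrite (inj_eq (bij_inj (perm_fun_bij a))).
Qed.

End Space.

(** Repetitions are allowed, so that finite [T] is covered; [t0] fills the indices outside the range
    of the injection into [nat]. *)
Lemma nat_surjection (T : Type) (t0 : T) : countable [set: T] ->
  exists e : nat -> T, forall t, exists n, e n = t.
Proof.
move=> /countable_injP[f finj]; pose p t n := f t = n.
have: forall n, exists t, (exists t, f t = n) -> f t = n.
  move=> n; have [[t <-]|nt] := pselect (exists t, f t = n); first by exists t.
  by exists t0.
move=> /choice[e eP]; exists e => t; exists (f t).
by apply: finj; rewrite ?in_setT//; apply: eP; exists t.
Qed.

(** * Baire category in the space of representations *)

Section Baire.
Variables (G : groupType) (X : choiceType) (eG : nat -> G) (eX : nat -> X).
Hypothesis eG_surj : forall g, exists n, eG n = g.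
Hypothesis eX_surj : forall x, exists n, eX n = x.

(* The points of the sequence below agree on a growing finite set exhausting
   [G * X], hence converge pointwise; the limit is again an action, and is by
   permutations because the values at [g] and [g^-1] converge together. *)
Lemma Hom_Baire (J : countType) (F : J -> set (Hom G X)) :
  (forall j, open (F j)) -> (forall j, dense (F j)) ->
  dense (\bigcap_j F j).
Proof.
move=> oF dF; apply/dense_HomP => phi c.
(* A state is a representation together with the finitely many pairs at which its values are
   frozen. *)
pose S := (Hom G X * seq (G * X))%type.
pose agree (s : S) psi :=
  {in s.2, forall p, act psi p.1 p.2 = act s.1 p.1 p.2}.
(* Stage [n] freezes the pairs with both indices below [n]; if [n] codes some [j], it also freezes
   enough values to force membership in [F j]. *)
have step (ns : nat * S) : exists t : S,
    [/\ {subset ns.2.2 <= t.2}, agree ns.2 t.1,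
      forall i k, i < ns.1 -> k < ns.1 -> (eG i, eX k) \in t.2 &
      forall psi j, unpickle ns.1 = Some j -> agree t psi -> F j psi].
  case: ns => n [psi d] /=.
  pose E := [seq (eG i, eX k) | i <- iota 0 n, k <- iota 0 n].
  have EP i k : i < n -> k < n -> (eG i, eX k) \in E.
    by move=> ? ?; apply: allpairs_f; rewrite mem_iota.
  case jn : (unpickle n) => [j|]; last first.
    by exists (psi, d ++ E); split=> //= [p pd|i k ? ?];
      rewrite mem_cat ?pd ?EP ?orbT.
  have [chi chid Fchi] := (dense_HomP (F j)).1 (dF j) psi d.
  have [r rF] := (open_HomP (F j)).1 (oF j) chi Fchi.
  exists (chi, r ++ d ++ E); split=> //= [p pd|i k ? ?|xi _ [<-] xir].
  - by rewrite !mem_cat pd orbT.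
  - by rewrite !mem_cat EP ?orbT.
  - by apply: rF => p pr; apply: xir; rewrite mem_cat pr.
have [next nextP] := choice step.
pose st := fix st n := if n is m.+1 then next (m, st m) else (phi, c).
have st_le n m : n <= m ->
    {subset (st n).2 <= (st m).2} /\ agree (st n) (st m).1.
  move=> /subnK <-; elim: (m - n)%N => [|k [IHs IHa]]; first by split.
  have [/= s1 a1 _ _] := nextP ((k + n)%N, st (k + n)%N).
  by split=> [p /IHs/s1//|p pn]; rewrite -(IHa _ pn); apply: a1; exact: IHs.
have: forall p : G * X, exists n, p \in (st n).2.
  move=> [g x]; have [i <-] := eG_surj g; have [k <-] := eX_surj x.
  (* Stage [m] freezes indices strictly below [m], and its result is [st m.+1]: hence two
     successors. *)
  exists (maxn i k).+2.
  have [_ _ /= inE _] := nextP ((maxn i k).+1, st (maxn i k).+1).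
  by apply: inE; rewrite ltnS ?leq_maxl ?leq_maxr.
move=> /choice[N NP].
pose f g x := act (st (N (g, x))).1 g x.
have fE n g x : (g, x) \in (st n).2 -> f g x = act (st n).1 g x.
  move=> gxn; have [le|/ltnW le] := leqP n (N (g, x)).
    by have [_ /(_ _ gxn)] := st_le _ _ le.
  by have [_ /(_ _ (NP (g, x)))] := st_le _ _ le.
have subN n p : N p <= n -> p \in (st n).2.
  by move=> /st_le[+ _]; apply; exact: NP.
have [|g h x|psi psiE] := @Hom_of_action G X f.
- by move=> x; rewrite /f act1.
(* By stage [n] the three values in the identity are final, and [st n] is already an action. *)
- pose n := maxn (N (g * h, x)) (maxn (N (h, x)) (N (g, f h x))).
  have fn : f h x = act (st n).1 h x.
    by apply/fE/subN; rewrite /n !leq_max leqnn orbT.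
  rewrite (fE n (g * h)) ?(fE n g) ?actM ?fn//; apply/subN; rewrite -?fn /n.
    by rewrite !leq_max leqnn !orbT.
  by rewrite leq_max leqnn.
have agr n : agree (st n) psi by move=> [g x] gxn; rewrite psiE (fE n).
exists psi; first exact: (agr 0).
move=> j _; have [_ _ _ /=] := nextP (pickle j, st (pickle j)).
by move=> /(_ psi j (pickleK j)); apply; exact: (agr (pickle j).+1).
Qed.

End Baire.

(** * Surgery: renaming points under finitely many constraints *)

Lemma extend_to_bijection (T : eqType) (Z : Type) (D : set Z) (A : seq T)
    (i : T -> Z) :
    ([set: T] #= D)%card -> {in A, forall x, D (i x)} ->
    {in A &, injective i} ->
  exists f : T -> Z, [/\ injective f, range f = D & {in A, f =1 i}].
Proof.
move=> TD; elim: A => [_ _|x A IHA iD iinj].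
  have /card_bijP[f [g fK gK]] := TD.
  pose u t : [set: T] := SigSub (mem_setT t).
  exists (fun t => \val (f (u t))); split=> // [s t /val_inj/(can_inj fK)|].
    by move=> /(congr1 val).
  apply/seteqP; split=> [_ [t _ <-]|z Dz]; first exact: set_valP.
  exists (\val (g (SigSub (mem_set Dz)))) => //.
  rewrite [u _](_ : _ = g (SigSub (mem_set Dz))) ?gK//.
  exact: val_inj.
have [f [finj fD fi]] : exists f : T -> Z,
    [/\ injective f, range f = D & {in A, f =1 i}].
  by apply: IHA => [y yA|y z yA zA]; [apply: iD|apply: iinj];
    rewrite inE ?yA ?zA orbT.
have [xA|xA] := boolP (x \in A).
  by exists f; split=> // y; rewrite inE => /predU1P[->|]; apply: fi.
have [x' _ fx'] : range f (i x) by rewrite fD; apply: iD; rewrite inE eqxx.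
(* Precomposing with the transposition of [x] and [x'] corrects the value at [x]. Values on [A]
   survive: [x] is not in [A], nor is [x'], as [i] is injective on [x :: A]. *)
pose t y := if y == x then x' else if y == x' then x else y.
have tK : involutive t.
  move=> y; rewrite /t; have [->|yx] := eqVneq y x.
    by have [//|_] := eqVneq x' x; rewrite eqxx.
  have [->|yx'] := eqVneq y x'; first by rewrite eqxx.
  by rewrite (negbTE yx) (negbTE yx').
exists (f \o t); split=> [|| y] /=.
- exact: inj_comp finj (inv_inj tK).
- rewrite -fD; apply/seteqP; split=> [_ [y _ <-]|_ [y _ <-]].
    by exists (t y).
  by exists (t y); rewrite //= tK.
- rewrite inE => /predU1P[->|yA]; first by rewrite /t eqxx.
  rewrite /t; have [yx|_] := eqVneq y x; first by rewrite -yx yA in xA.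
  have [yx'|_] := eqVneq y x'; last exact: fi.
  case/negP: xA; have <- // : y = x.
  by apply: iinj; rewrite ?inE ?yA ?eqxx ?orbT// -(fi y yA) yx'.
Qed.

Section Surgery.
Variables (G : groupType) (X : choiceType) (eG : nat -> G) (eX : nat -> X).
Hypothesis eG_surj : forall g, exists n, eG n = g.
Hypothesis eX_surj : forall x, exists n, eX n = x.
Hypothesis X_infinite : infinite_set [set: X].

Definition touched (phi : Hom G X) (c : seq (G * X)) : seq X :=
  [seq p.2 | p <- c] ++ [seq act phi p.1 p.2 | p <- c].

Lemma mem_touched phi c p : p \in c ->
  (p.2 \in touched phi c) * (act phi p.1 p.2 \in touched phi c).
Proof.
by move=> pc; split; rewrite mem_cat; apply/orP; [left|right]; apply/mapP; exists p.
Qed.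

Lemma eX_countable : countable [set: X].
Proof.
apply: (@sub_countable _ nat [set: X] [set: nat]) => //.
suff -> : [set: X] = range eX by exact: card_image_le.
by apply/seteqP; split=> // x _; have [n] := eX_surj x; exists n.
Qed.

(** The common engine of all surgeries. [X] and [D] are both countably infinite, so [i] on [A]
    extends to a bijection, along which the action on [D] is pulled back; [c] survives because [i]
    is equivariant on it and [A] holds every point it mentions. *)
Lemma transport (Z : Type) (az : G -> Z -> Z) (D : set Z) (phi : Hom G X)
    (c : seq (G * X)) (A : seq X) (i : X -> Z) :
    (forall z, az 1 z = z) ->
    (forall g h z, az (g * h) z = az g (az h z)) ->
    (forall g z, D z -> D (az g z)) ->
    countable D -> infinite_set D ->
    {subset touched phi c <= A} -> {in A, forall x, D (i x)} ->
    {in A &, injective i} ->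
    {in c, forall p, i (act phi p.1 p.2) = az p.1 (i p.2)} ->
  exists psi, exists2 f : X -> Z,
    {in c, forall p, act psi p.1 p.2 = act phi p.1 p.2} &
    [/\ injective f, range f = D, {in A, f =1 i} &
      forall g x, f (act psi g x) = az g (f x)].
Proof.
move=> az1 azM azD cD iD cA AD iinj ic.
have XD : ([set: X] #= D)%card.
  have XN := eq_card_nat eX_countable X_infinite.
  by rewrite (card_eql XN) card_eq_sym; exact: eq_card_nat.
have [f [finj fD fi]] := extend_to_bijection XD AD iinj.
have: forall p : G * X, exists y, f y = az p.1 (f p.2).
  move=> [g x]; have : D (az g (f x)) by apply: azD; rewrite -fD; exists x.
  by rewrite -fD => -[y _ fy]; exists y.
move=> /choice[u uP].
have [||psi psiE] := @Hom_of_action G X (fun g x => u (g, x)).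
- by move=> x; apply: finj; rewrite uP /= az1.
- by move=> g h x; apply: finj; rewrite !uP /= ?uP azM.
have fpsi g x : f (act psi g x) = az g (f x) by rewrite psiE uP.
exists psi, f => // p pc; apply: finj; have [p2 p12] := mem_touched phi pc.
by rewrite fpsi !fi ?ic//; exact: cA.
Qed.

(** The coset is a subset of [G], so equality of cosets is plain equality and no quotient is
    formed. *)
Definition lcoset (L : Subgrp G) (k : G) : set G := [set h | mem_sub L (k^-1 * h)].

Lemma lcoset_eq L k l : lcoset L k = lcoset L l <-> mem_sub L (k^-1 * l).
Proof.
split=> [kl|kl].
  have : lcoset L l l by rewrite /lcoset /= mulVg; exact: mem_sub1.
  by rewrite -kl.
rewrite /lcoset; apply/seteqP; split=> h /= kh.
  by have := mem_subM (mem_subV kl) kh; rewrite invgM invgK mulgA mulgK.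
by have := mem_subM kl kh; rewrite mulgA mulgK.
Qed.

(** The right summand carries left translation of arbitrary subsets; invariant families such as
    [G/L] are cut out later. *)
Definition sum_act (phi : Hom G X) (g : G) (z : X + set G) : X + set G :=
  match z with
  | inl x => inl (act phi g x)
  | inr B => inr [set h | B (g^-1 * h)]
  end.

Lemma sum_act_lcoset phi g L k :
  sum_act phi g (inr (lcoset L k)) = inr (lcoset L (g * k)).
Proof.
by congr inr; apply/seteqP; split=> h; rewrite /lcoset /= invgM mulgA.
Qed.

(* Realizing [L] as a stabilizer: the point set is renamed so as to carry the
   action on [X + G/L], whose summand [X] keeps enough room for [phi]. *)
Lemma add_coset_space (phi : Hom G X) (c : seq (G * X)) (L : Subgrp G)
    (A : seq X) (i : X -> X + set G) :
    {subset touched phi c <= A} ->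
    {in A, forall x, (exists y, i x = inl y) \/
      (exists k, i x = inr (lcoset L k))} ->
    {in A &, injective i} ->
    {in c, forall p, i (act phi p.1 p.2) = sum_act phi p.1 (i p.2)} ->
  exists psi, exists2 f : X -> X + set G,
    {in c, forall p, act psi p.1 p.2 = act phi p.1 p.2} &
    [/\ {in A, f =1 i}, exists x, f x = inr (lcoset L 1) &
      forall x, f x = inr (lcoset L 1) -> stab psi x = L].
Proof.
move=> cA iD iinj ic.
pose u (b : nat + nat) : X + set G :=
  match b with inl n => inl (eX n) | inr n => inr (lcoset L (eG n)) end.
have uX x : range u (inl x) by have [n <-] := eX_surj x; exists (inl n).
have uG k : range u (inr (lcoset L k)).
  by have [n <-] := eG_surj k; exists (inr n).
have [||||||x xA|||psi [f agr [finj fD fi fpsi]]] :=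
    @transport _ (sum_act phi) (range u) phi c A i.
- case=> [x|B] /=; rewrite ?act1//.
  by congr inr; apply/seteqP; split=> h; rewrite /= invg1 mul1g.
- move=> g h [x|B] /=; rewrite ?actM//.
  by congr inr; apply/seteqP; split=> k; rewrite /= invgM mulgA.
- move=> g _ [[n|n] _ <-]; first exact: uX.
  by rewrite sum_act_lcoset; exact: uG.
- apply: (@sub_countable _ _ (range u) [set: nat + nat]); last exact: countableP.
  exact: card_image_le.
- have [x0 _] := infinite_setN0 X_infinite.
  pose v (z : X + set G) := if z is inl x then x else x0.
  move=> /(finite_image v) Dfin; apply: X_infinite.
  by apply: sub_finite_set Dfin => x _; exists (inl x).
- by [].
- by have [[y ->]|[k ->]] := iD x xA.
- by [].
- by [].
exists psi, f => //; split=> // [|x fx].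
  by have := uG 1; rewrite -fD => -[x _ fx]; exists x.
apply: Subgrp_ext => g; rewrite mem_stab; have := fpsi g x.
rewrite fx sum_act_lcoset mulg1 => fgx; apply/eqP/idP => [gx|Lg].
  move: fgx; rewrite gx fx => -[/lcoset_eq].
  by rewrite invg1 mul1g.
apply: finj; rewrite fgx fx; congr inr; apply/lcoset_eq.
by rewrite mulg1; exact: mem_subV.
Qed.

Lemma orbit_representatives (phi : Hom G X) (x : X) :
  exists r : X -> G, forall g, act phi (r (act phi g x)) x = act phi g x.
Proof.
have : forall y, exists k, (exists g, act phi g x = y) -> act phi k x = y.
  move=> y; have [[g gy]|ny] := pselect (exists g, act phi g x = y).
    by exists g.
  by exists 1.
by move=> /choice[r rP]; exists r => g; apply: rP; exists g.
Qed.

Lemma mem_stabVM (phi : Hom G X) x g h :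
  mem_sub (stab phi x) (g^-1 * h) = (act phi g x == act phi h x).
Proof.
by rewrite mem_stab actM eq_sym -(inj_eq (@act_inj _ _ phi g)) actKV.
Qed.

(** The orbit of [x] is replaced by [G/L], the point [r a] applied to [x] becoming the coset of
    [r a]. Only finitely many memberships decide whether the touched points stay distinct and [c]
    stays valid. *)
Lemma perturb_stab (phi : Hom G X) (c : seq (G * X)) (x : X) :
  exists K : seq G, forall L, {in K, mem_sub L =1 mem_sub (stab phi x)} ->
  exists2 psi, {in c, forall p, act psi p.1 p.2 = act phi p.1 p.2} &
    stab psi x = L.
Proof.
have [r rP] := orbit_representatives phi x.
pose A := x :: touched phi c.
(* [K1] keeps touched points in distinct cosets; [K2] makes the cosets obey the equations in [c]. *)
pose K1 := [seq (r a)^-1 * r b | a <- A, b <- A].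
pose K2 := [seq (p.1 * r p.2)^-1 * r (act phi p.1 p.2) | p <- c].
(* [r x] fixes [x] but need not be [1]; this entry forces it into [L], so [x] goes to the base
   coset. *)
exists (1^-1 * r x :: K1 ++ K2) => L LK.
have Lx : mem_sub L (1^-1 * r x).
  by rewrite LK ?inE ?eqxx// mem_stabVM act1; have := rP 1; rewrite act1 => ->.
pose i y : X + set G :=
  if `[< exists g, act phi g x = y >] then inr (lcoset L (r y)) else inl y.
have iin y : (exists g, act phi g x = y) -> i y = inr (lcoset L (r y)).
  by move=> gy; rewrite /i; case: asboolP.
have iout y : ~ (exists g, act phi g x = y) -> i y = inl y.
  by move=> gy; rewrite /i; case: asboolP.
have rE y : (exists g, act phi g x = y) -> act phi (r y) x = y.
  by move=> [g <-].
have [|a aA|a b aA bA|p pc|psi [f agr [fi _ fL]]] :=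
    @add_coset_space phi c L A i.
- by move=> y yc; rewrite inE yc orbT.
- by have [/iin ->|/iout ->] := pselect (exists g, act phi g x = a);
    [right|left]; eexists.
- have [ga|ga] := pselect (exists g, act phi g x = a);
    have [gb|gb] := pselect (exists g, act phi g x = b).
  + rewrite !iin// => -[/lcoset_eq].
    rewrite LK; last first.
      by rewrite inE mem_cat (allpairs_f (fun a b => (r a)^-1 * r b)) ?orbT.
    by rewrite mem_stabVM !rE// => /eqP.
  + by rewrite iin// iout.
  + by rewrite iout// iin.
  + by rewrite !iout// => -[].
- case: p pc => g a pc /=.
  have [ga|ga] := pselect (exists g, act phi g x = a).
    have gga : exists h, act phi h x = act phi g a.
      by case: ga => h <-; exists (g * h); rewrite actM.
    rewrite !iin// sum_act_lcoset; congr inr; apply/esym/lcoset_eq.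
    rewrite LK; last first.
      by rewrite inE mem_cat (map_f _ pc) ?orbT.
    by rewrite mem_stabVM rE// actM rE.
  rewrite !iout// => -[h hga]; apply: ga; exists (g^-1 * h).
  by rewrite actM hga actK.
exists psi => //; apply: fL; rewrite fi ?inE ?eqxx// iin.
  by congr inr; apply/esym/lcoset_eq.
by exists 1; rewrite act1.
Qed.

(** [A] and the touched points stay in the summand [X], so the base coset is carried by a point
    outside [A]. *)
Lemma add_orbit (phi : Hom G X) (c : seq (G * X)) (A : seq X) (L : Subgrp G) :
  exists2 psi, {in c, forall p, act psi p.1 p.2 = act phi p.1 p.2} &
    exists2 x, x \notin A & stab psi x = L.
Proof.
have [||||psi [f agr [fi [x fx] fL]]] :=
    @add_coset_space phi c L (A ++ touched phi c) inl.
- by move=> y yc; rewrite mem_cat yc orbT.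
- by move=> y _; left; exists y.
- by move=> y z _ _ [].
- by [].
exists psi => //; exists x; last exact: fL.
by apply/negP => xA; move: fx; rewrite fi ?mem_cat ?xA.
Qed.

(** An equivalence, since a conjugate of an infinite subgroup may be properly contained in it. *)
Definition normalizes (L : Subgrp G) (g : G) : Prop :=
  forall h, mem_sub L (g^-1 * h * g) = mem_sub L h.

Definition finite_index_in_normalizer (L : Subgrp G) : Prop :=
  exists s : seq G, forall g, normalizes L g ->
    exists2 k, k \in s & mem_sub L (k^-1 * g).

Lemma stab_actP (phi : Hom G X) x g :
  stab phi (act phi g x) = stab phi x <-> normalizes (stab phi x) g.
Proof.
have E h : mem_sub (stab phi (act phi g x)) h = mem_sub (stab phi x) (g^-1 * h * g).
  by rewrite -mulgA mem_stabVM mem_stab actM eq_sym.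
split=> [gx h|gL]; first by rewrite -E gx.
by apply: Subgrp_ext => h; rewrite E gL.
Qed.

(* When [N(L)/L] is infinite, two orbits of type [G/L] can be merged by moving
   the second one along an automorphism of the first that avoids the finitely
   many points under control. *)
Lemma merge_orbits (phi : Hom G X) (c : seq (G * X)) (x y : X) :
    stab phi y = stab phi x ->
    ~ finite_index_in_normalizer (stab phi x) ->
    ~ (exists g, act phi g x = y) ->
  exists2 psi, {in c, forall p, act psi p.1 p.2 = act phi p.1 p.2} &
    stab psi x = stab phi x /\ exists g, act psi g x = y.
Proof.
move=> xy Lfin nxy.
have [r rP] := orbit_representatives phi y.
have [q qP] := orbit_representatives phi x.
pose A := x :: y :: touched phi c.
(* A point [z] outside [E] has no translate by [r a], [a] in [A], that falls into [A]. *)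
pose E := [seq act phi (r a)^-1 b | a <- A, b <- A].
have [w wL wE] : exists2 w, normalizes (stab phi x) w & act phi w x \notin E.
  apply: contrapT => H; apply: Lfin; exists (map q E) => g gL.
  have gE : act phi g x \in E.
    by apply: contrapT => /negP gE; apply: H; exists g.
  exists (q (act phi g x)); first exact: map_f.
  by rewrite mem_stabVM qP.
set z := act phi w x in wE.
have zy : stab phi z = stab phi y by rewrite xy; apply/stab_actP.
(* [i] folds the orbit of [y] onto that of [x], sending [y] to [z]; equal stabilizers make it
   equivariant. It is injective on [A] only, by the choice of [z]. *)
pose i a := if `[< exists g, act phi g y = a >] then act phi (r a) z else a.
have iin a : (exists g, act phi g y = a) -> i a = act phi (r a) z.
  by move=> gy; rewrite /i; case: asboolP.
have iout a : ~ (exists g, act phi g y = a) -> i a = a.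
  by move=> gy; rewrite /i; case: asboolP.
have rE a : (exists g, act phi g y = a) -> act phi (r a) y = a.
  by move=> [g <-].
have zyE g h : act phi g z = act phi h z <-> act phi g y = act phi h y.
  split=> /eqP; rewrite -mem_stabVM.
    by rewrite zy mem_stabVM => /eqP.
  by rewrite -zy mem_stabVM => /eqP.
have iinj : {in A &, injective i}.
  move=> a b aA bA; have [ga|ga] := pselect (exists g, act phi g y = a);
    have [gb|gb] := pselect (exists g, act phi g y = b).
  - by rewrite !iin// zyE !rE.
  - rewrite iin// iout// => ab; case/negP: wE; apply/allpairsP.
    by exists (a, b); split=> //=; rewrite -ab actK.
  - rewrite iout// iin// => ab; case/negP: wE; apply/allpairsP.
    by exists (b, a); split=> //=; rewrite ab actK.
  - by rewrite !iout.
have iact g a : i (act phi g a) = act phi g (i a).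
  have [ga|ga] := pselect (exists g, act phi g y = a).
    have gga : exists h, act phi h y = act phi g a.
      by case: ga => h <-; exists (g * h); rewrite actM.
    by rewrite !iin// -actM; apply/zyE; rewrite actM !rE.
  rewrite !iout// => -[h hga]; apply: ga; exists (g^-1 * h).
  by rewrite actM hga actK.
(* The target is [X] under [phi] itself: [psi] is a conjugate of [phi] in which [x] and [y] share an
   orbit. *)
have [||||||||p pc|psi [f agr [finj _ fi fpsi]]] :=
    @transport _ (act phi) [set: X] phi c A i.
- exact: act1.
- exact: actM.
- by [].
- exact: eX_countable.
- exact: X_infinite.
- by move=> a ac; rewrite !inE ac !orbT.
- by [].
- exact: iinj.
- exact: iact.
have fx : f x = x.
  rewrite fi ?inE ?eqxx// iout// => -[g gy]; apply: nxy; exists g^-1.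
  by rewrite -gy actK.
have fy : f y = z.
  rewrite fi ?inE ?eqxx ?orbT// iin; last by exists 1; rewrite act1.
  rewrite -[RHS](act1 phi); apply/zyE; rewrite act1; apply: rE.
  by exists 1; rewrite act1.
exists psi => //; split; last by exists w; apply: finj; rewrite fpsi fx fy.
apply: Subgrp_ext => g; rewrite !mem_stab.
by rewrite -[in RHS]fx -fpsi; apply/eqP/eqP => [->//|/finj].
Qed.

End Surgery.

(** * Rich representations and back-and-forth *)

Section Rich.
Variables (G : groupType) (X : choiceType) (eG : nat -> G) (eX : nat -> X).
Hypothesis eG_surj : forall g, exists n, eG n = g.
Hypothesis eX_surj : forall x, exists n, eX n = x.

(* If [N(L)/L] is finite then each orbit has finitely many points with
   stabilizer [L], so the last clause provides infinitely many orbits of type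
   [G/L]; otherwise the second clause leaves only one. *)
Definition rich (phi : Hom G X) : Prop :=
  [/\ forall x, isolated_subgroups (stab phi x),
      forall x y, stab phi y = stab phi x ->
        ~ finite_index_in_normalizer (stab phi x) -> exists g, act phi g x = y &
      forall L (A : seq X), isolated_subgroups L ->
        exists2 x, x \notin A & stab phi x = L].

(** Within one orbit, the points with stabilizer [L] are permuted simply transitively by [N(L)/L],
    hence are finitely many. *)
Lemma finite_stab_fiber (psi : Hom G X) (L : Subgrp G) (B : seq X) :
  finite_index_in_normalizer L ->
  exists A : seq X, forall z, stab psi z = L ->
    (exists2 b, b \in B & exists g, act psi g b = z) -> z \in A.
Proof.
move=> [s sL]; elim: B => [|b B [A AP]]; first by exists [::] => z _ [].
have [[g0 g0L]|nb] := pselect (exists g, stab psi (act psi g b) = L); last first.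
  exists A => z zL [a]; rewrite inE => /predU1P[->|aB] [g gz].
    by case: nb; exists g; rewrite gz.
  by apply: AP => //; exists a => //; exists g.
set b0 := act psi g0 b in g0L.
exists ([seq act psi k b0 | k <- s] ++ A) => z zL [a].
rewrite inE mem_cat => /predU1P[->|aB] [g gz]; last first.
  by apply/orP; right; apply: AP => //; exists a => //; exists g.
have hz : act psi (g * g0^-1) b0 = z by rewrite actM actK.
have /stab_actP : stab psi (act psi (g * g0^-1) b0) = stab psi b0.
  by rewrite hz zL.
rewrite g0L => /sL[k ks]; rewrite -g0L mem_stabVM hz => /eqP <-.
by apply/orP; left; exact: (map_f (fun k => act psi k b0)).
Qed.

(** [g = 1] makes [s] a partial injection, [p = q] equates stabilizers; [s] thus induces an
    equivariant bijection between the orbits it meets. *)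
Definition partial_iso (phi psi : Hom G X) (s : seq (X * X)) : Prop :=
  forall p q, p \in s -> q \in s ->
    forall g, act phi g p.1 = q.1 <-> act psi g p.2 = q.2.

Definition swap (p : X * X) : X * X := (p.2, p.1).

Lemma partial_iso_swap phi psi s :
  partial_iso phi psi s -> partial_iso psi phi (map swap s).
Proof.
by move=> sP _ _ /mapP[p ps ->] /mapP[q qs ->] g; apply: iff_sym; exact: sP.
Qed.

Lemma partial_iso_extend phi psi s x :
  rich phi -> rich psi -> partial_iso phi psi s ->
  exists y, partial_iso phi psi ((x, y) :: s).
Proof.
move=> [phii phi1 _] [_ _ psioo] sP.
have [[p ps [g gp]]|nx] :=
    pselect (exists2 p, p \in s & exists g, act phi g p.1 = x).
  exists (act psi g p.2) => q r; rewrite !inE.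
  have E q' h : q' \in s ->
      act phi h q'.1 = x <-> act psi h q'.2 = act psi g p.2.
    move=> q's; have := sP _ _ q's ps (g^-1 * h); rewrite !actM -gp => H.
    split=> [hq|hq].
      by rewrite -(H.1 _) ?actKV// hq actK.
    by rewrite -(H.2 _) ?actKV// hq actK.
  move=> /predU1P[->|qs] /predU1P[->|rs] h /=.
  - by rewrite -gp -!actM; have := E p (h * g) ps; rewrite gp.
  - by rewrite -gp -!actM; exact: sP.
  - exact: E.
  - exact: sP.
have [y yL yout] : exists2 y, stab psi y = stab phi x &
    forall p, p \in s -> ~ exists g, act psi g p.2 = y.
  have [Lfin|Lfin] := pselect (finite_index_in_normalizer (stab phi x)).
    (* The orbits already used hold finitely many points with this stabilizer; richness supplies
       another. *)
    have [A AP] := finite_stab_fiber psi (map snd s) Lfin.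
    have [y yA yL] := psioo _ A (phii x); exists y => // p ps gp.
    by case/negP: yA; apply: AP => //; exists p.2 => //; exact: map_f.
  (* Any [y] works: were it in a used orbit, the matching orbit of [phi] would contain a point with
     the stabilizer of [x], hence [x] itself by uniqueness. *)
  have [y _ yL] := psioo _ [::] (phii x); exists y => // p ps [g gp].
  have gx : stab phi (act phi g p.1) = stab phi x.
    rewrite -yL -gp; apply: Subgrp_ext => h; rewrite !mem_stab -!actM.
    have H := sP _ _ ps ps (g^-1 * h * g).
    have E q (chi : Hom G X) :
        act chi (h * g) q = act chi g q <-> act chi (g^-1 * h * g) q = q.
      rewrite -mulgA [act chi (g^-1 * _) q]actM.
      by split=> [->|hq]; rewrite ?actK// -{2}hq actKV.
    by apply/eqP/eqP => /E/H/E.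
  have [h hx] := phi1 _ _ gx Lfin; apply: nx; exists p => //.
  by exists (h^-1 * g); rewrite actM -hx actK.
have xy g : act phi g x = x <-> act psi g y = y.
  have := congr1 (fun H => mem_sub H g) yL; rewrite !mem_stab => E.
  by split=> /eqP ?; apply/eqP; rewrite ?E// -E.
exists y => q r; rewrite !inE => /predU1P[->|qs] /predU1P[->|rs] h /=.
- exact: xy.
- split=> hr; exfalso; last by apply: (yout r rs); exists h^-1; rewrite -hr actK.
  by apply: nx; exists r => //; exists h^-1; rewrite -hr actK.
- split=> hq; exfalso; last by apply: (yout q qs); exists h.
  by apply: nx; exists q => //; exists h.
- exact: sP.
Qed.

Lemma rich_conj (phi psi : Hom G X) :
  rich phi -> rich psi -> exists a, conj_hom a phi = psi.
Proof.
move=> phir psir.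
have step (ns : nat * seq (X * X)) : exists t : seq (X * X),
    partial_iso phi psi ns.2 ->
    [/\ partial_iso phi psi t, {subset ns.2 <= t},
      exists y, (eX ns.1, y) \in t & exists x, (x, eX ns.1) \in t].
  case: ns => n s /=; have [sP|nsP] := pselect (partial_iso phi psi s); last first.
    by exists [::].
  have [y yP] := partial_iso_extend (eX n) phir psir sP.
  have [x xP] := partial_iso_extend (eX n) psir phir (partial_iso_swap yP).
  exists ((x, eX n) :: (eX n, y) :: s) => _; split.
  - have := partial_iso_swap xP; rewrite /= -map_comp map_id_in// => -[].
    by [].
  - by move=> p ps; rewrite !inE ps !orbT.
  - by exists y; rewrite !inE eqxx orbT.
  - by exists x; rewrite inE eqxx.
have [next nextP] := choice step.
pose st := fix st n := if n is m.+1 then next (m, st m) else [::].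
have stP n : partial_iso phi psi (st n).
  by elim: n => [|n IHn] //=; have [] := nextP (n, st n) IHn.
have st_le n m : n <= m -> {subset (st n) <= (st m)}.
  move=> /subnK <-; elim: (m - n)%N => [|k IHs] // p /IHs.
  by have [_ + _ _] := nextP ((k + n)%N, st (k + n)%N) (stP _); apply.
have stE n m p q g : p \in st n -> q \in st m ->
    act phi g p.1 = q.1 <-> act psi g p.2 = q.2.
  move=> pn qm; apply: (stP (maxn n m)).
    exact: st_le (leq_maxl _ _) _ pn.
  exact: st_le (leq_maxr _ _) _ qm.
have: forall x, exists y, exists n, (x, y) \in st n.
  move=> x; have [n <-] := eX_surj x.
  by have [_ _ [y yn] _] := nextP (n, st n) (stP n); exists y, n.+1.
move=> /choice[f fP].
have: forall y, exists x, exists n, (x, y) \in st n.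
  move=> x; have [n <-] := eX_surj x.
  by have [_ _ _ [y yn]] := nextP (n, st n) (stP n); exists y, n.+1.
move=> /choice[h hP].
have fbij : bijective f.
  (* The isomorphism condition at [g = 1] shows that [f] and [h] are mutually inverse. *)
  exists h => x.
    have [[n fn] [m hm]] := (fP x, hP (f x)).
    by have := stE _ _ _ _ 1 fn hm; rewrite /= !act1 => -[_ /(_ erefl)].
  have [[n fn] [m hm]] := (fP (h x), hP x).
  by have := stE _ _ _ _ 1 hm fn; rewrite /= !act1 => -[/(_ erefl)].
exists (mkperm fbij); apply: conj_homP => g x; rewrite mkpermE.
have [[n fn] [m fm]] := (fP x, fP (act phi g x)).
by have := stE _ _ _ _ g fn fm => -[/(_ erefl)].
Qed.

(** * Richness as countably many open dense conditions *)

Hypothesis X_infinite : infinite_set [set: X].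

Lemma open_stab_in (K : seq G) (b : G -> bool) (x : X) :
  open [set phi : Hom G X | {in K, mem_sub (stab phi x) =1 b}].
Proof.
apply/open_HomP => phi phib; exists [seq (g, x) | g <- K] => psi psiphi g gK.
rewrite -phib// !mem_stab; congr (_ == _).
by have /= -> // := psiphi (g, x); exact: map_f.
Qed.

Lemma open_stab_neq (L : Subgrp G) (x : X) :
  open [set phi : Hom G X | stab phi x <> L].
Proof.
apply/open_HomP => phi phiL.
have [g gL] : exists g, mem_sub (stab phi x) g <> mem_sub L g.
  apply: contrapT => H; apply: phiL; apply: Subgrp_ext => g.
  by apply: contrapT => gL; apply: H; exists g.
exists [:: (g, x)] => psi psiphi psiL; apply: gL; rewrite -psiL !mem_stab.
by have /= -> // := psiphi (g, x); rewrite inE.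
Qed.

Lemma Gdelta_dense_bigcap (T : topologicalType) (J : countType)
    (F : J -> set T) :
  (forall j, open (F j)) -> (forall j, dense (F j)) ->
  Gdelta_dense (\bigcap_j F j).
Proof.
move=> oF dF.
(* Indices coding no [j] get the whole space. *)
exists (fun n => if unpickle n is Some j then F j else setT).
  move=> n; case: unpickle => [j|]; split; [exact: oF|exact: dF|exact: openT|].
  by move=> U U0 _; rewrite setIT.
apply/seteqP; split=> [x Fx n _|x Fx j _].
  by case: unpickle => // j; exact: Fx.
by have := Fx (pickle j) I; rewrite pickleK.
Qed.

(** Isolation is bundled with the merging clause because openness of the latter relies on it. *)
Definition rich_orbits (xy : nat * nat) : set (Hom G X) :=
  let x := eX xy.1 in let y := eX xy.2 in
  [set phi | isolated_subgroups (stab phi x) /\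
    (stab phi y = stab phi x ->
     ~ finite_index_in_normalizer (stab phi x) -> exists g, act phi g x = y)].

(** [bm.1] codes a basic open set of subgroups, so that countably many conditions cover every
    isolated [L]. *)
Definition rich_multiplicity (bm : seq (nat * bool) * nat) : set (Hom G X) :=
  let matches (L : Subgrp G) := {in bm.1, forall p, mem_sub L (eG p.1) = p.2} in
  [set phi | (exists L, matches L) ->
    exists x, x \notin map eX (iota 0 bm.2) /\ matches (stab phi x)].

(** Isolation makes the stabilizer of [x] locally constant. Each way for the implication to hold
    then persists: a witness [g], finiteness of [N(L)/L], or a different stabilizer at [y]. *)
Lemma open_rich_orbits xy : open (rich_orbits xy).
Proof.
case: xy => m n; apply/open_HomP => phi [/isolatedP[K KP]].
set x := eX m; set y := eX n => H /=.
have near (c : seq (G * X)) : {subset [seq (g, x) | g <- K] <= c} ->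
    forall psi : Hom G X,
    {in c, forall p, act psi p.1 p.2 = act phi p.1 p.2} ->
    stab psi x = stab phi x.
  move=> Kc psi psic; apply: KP => g gK; rewrite !mem_stab.
  by have /= -> // := psic (g, x); apply: Kc; exact: map_f.
have [[g gxy]|nxy] := pselect (exists g, act phi g x = y).
  exists ((g, x) :: [seq (g, x) | g <- K]) => psi psic.
  have psix : stab psi x = stab phi x.
    by apply: near psic => p pK; rewrite inE pK orbT.
  split; first by rewrite psix; apply/isolatedP; exists K.
  by move=> _ _; exists g; have /= -> // := psic (g, x); rewrite inE eqxx.
have [Lfin|Lfin] := pselect (finite_index_in_normalizer (stab phi x)).
  exists [seq (g, x) | g <- K] => psi /(near _ (fun _ => id) psi) psix.
  by split; rewrite psix//; apply/isolatedP; exists K.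
have yx : stab phi y <> stab phi x by move=> yx; exact/nxy/H.
have [c cP] := (open_HomP _).1 (open_stab_neq (stab phi x) y) phi yx.
exists (c ++ [seq (g, x) | g <- K]) => psi psic.
have psix : stab psi x = stab phi x.
  by apply: near psic => p pK; rewrite mem_cat pK orbT.
split; first by rewrite psix; apply/isolatedP; exists K.
rewrite psix => psiyx; exfalso; apply: cP psiyx => p pc.
by apply: psic; rewrite mem_cat pc.
Qed.

(** Solitarity allows a perturbation making the stabilizer of [x] isolated; if the implication still
    fails, merging repairs it and keeps that stabilizer. *)
Lemma dense_rich_orbits xy : solitary G -> dense (rich_orbits xy).
Proof.
case: xy => m n /dense_SubgrpP Gsol; apply/dense_HomP => phi0 c.
set x := eX m; set y := eX n.
have [K KP] := perturb_stab eG_surj eX_surj X_infinite phi0 c x.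
have [L LK Lisol] := Gsol (stab phi0 x) K.
have [phi phic phiL] := KP L LK.
have [H|] := pselect (rich_orbits (m, n) phi); first by exists phi.
rewrite /rich_orbits /= -/x -/y => H.
have [yx [Lfin nxy]] : stab phi y = stab phi x /\
    (~ finite_index_in_normalizer (stab phi x) /\ ~ exists g, act phi g x = y).
  split; last split; apply: contrapT => H'; apply: H;
    by split; [rewrite phiL | move=> *; apply: contrapT => ?; apply: H'].
have [psi psic [psix psiy]] := merge_orbits eX_surj X_infinite c yx Lfin nxy.
exists psi; first by move=> p pc; rewrite psic// phic.
by split; rewrite /= -/x -/y// psix phiL.
Qed.

Lemma open_rich_multiplicity bm : open (rich_multiplicity bm).
Proof.
case: bm => b m; apply/open_HomP => phi /= phibm.
have [[L Lb]|nL] := pselect (exists L : Subgrp G,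
    {in b, forall p, mem_sub L (eG p.1) = p.2}); last first.
  by exists [::] => psi _ [L Lb]; case: nL; exists L.
have [|x [xm xb]] := phibm; first by exists L.
exists [seq (eG p.1, x) | p <- b] => psi psiphi _; exists x; split=> // p pb.
rewrite -xb// !mem_stab; congr (_ == _).
by have /= -> // := psiphi (eG p.1, x); exact: (map_f (fun p => (eG p.1, x))).
Qed.

Lemma dense_rich_multiplicity bm : dense (rich_multiplicity bm).
Proof.
case: bm => b m; apply/dense_HomP => phi c.
have [[L Lb]|nL] := pselect (exists L : Subgrp G,
    {in b, forall p, mem_sub L (eG p.1) = p.2}); last first.
  by exists phi => // -[L Lb]; case: nL; exists L.
have [psi psic [x xm xL]] :=
  add_orbit eG_surj eX_surj X_infinite phi c (map eX (iota 0 m)) L.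
by exists psi => // _; exists x; rewrite /= xL.
Qed.


Definition rich_conditions (j : nat * nat + seq (nat * bool) * nat) :
    set (Hom G X) :=
  match j with inl xy => rich_orbits xy | inr bm => rich_multiplicity bm end.

Lemma rich_bigcap : \bigcap_j rich_conditions j `<=` rich.
Proof.
move=> phi phiP.
have orb x y : isolated_subgroups (stab phi x) /\
    (stab phi y = stab phi x ->
     ~ finite_index_in_normalizer (stab phi x) -> exists g, act phi g x = y).
  have [[m <-] [n <-]] := (eX_surj x, eX_surj y).
  exact: (phiP (inl (m, n)) I).
split=> [x|x y|L A /isolatedP[K KL]].
- by have [] := orb x x.
- by have [] := orb x y.
have [u uP] := choice eG_surj; have [v vP] := choice eX_surj.
pose b := [seq (u g, mem_sub L g) | g <- K].
have bP M : {in b, forall p, mem_sub M (eG p.1) = p.2} <->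
    {in K, mem_sub M =1 mem_sub L}.
  split=> [Mb g gK|MK _ /mapP[g gK ->]]; last by rewrite /= uP MK.
  have /= := Mb (u g, mem_sub L g); rewrite uP; apply.
  exact: (map_f (fun g => (u g, mem_sub L g))).
(* The bound exceeds the index [v a] of every [a] in [A], so all of [A] is avoided. *)
have [|x [xA xb]] := phiP (inr (b, (\max_(a <- A) v a).+1)) I.
  by exists L; apply/bP.
exists x; last by apply: KL; apply/bP.
apply: contra xA => xA; apply/mapP; exists (v x); last by rewrite vP.
by rewrite mem_iota ltnS (@leq_bigmax_seq _ _ _ v).
Qed.

Lemma rich_conditions_comeager : solitary G ->
  forall j, open (rich_conditions j) /\ dense (rich_conditions j).
Proof.
move=> Gsol [xy|bm]; split.
- exact: open_rich_orbits.
- exact: dense_rich_orbits.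
- exact: open_rich_multiplicity.
- exact: dense_rich_multiplicity.
Qed.

Lemma Hom_inhabited : exists phi : Hom G X, True.
Proof. by have [//|//|phi _] := @Hom_of_action G X (fun=> id); exists phi. Qed.

Lemma generic_of_solitary : solitary G -> has_generic_representation G X.
Proof.
move=> /rich_conditions_comeager cond.
have [phi0 _] := Hom_inhabited.
have [tau _ tauP] := (dense_HomP _).1 (Hom_Baire eG_surj eX_surj
  (fun j => (cond j).1) (fun j => (cond j).2)) phi0 [::].
exists tau, (\bigcap_j rich_conditions j).
  by apply: Gdelta_dense_bigcap => j; have [] := cond j.
move=> psi /rich_bigcap psir.
have [a <-] := rich_conj (rich_bigcap tauP) psir.
by exists a.
Qed.

(** * Stabilizers of a generic representation *)

Lemma generic_stab_isolated (tau : Hom G X) (x0 : X) :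
  comeager (conj_orbit tau) -> isolated_subgroups (stab tau x0).
Proof.
move=> [_ [F FP ->] Ftau]; apply: contrapT => nisol.
set L := stab tau x0 in nisol.
(* [L] is excluded at every point, because a conjugation may move [x0] anywhere. *)
pose E (j : nat + nat) : set (Hom G X) :=
  match j with inl n => F n | inr n => [set phi | stab phi (eX n) <> L] end.
have dE : dense (\bigcap_j E j).
  apply: (Hom_Baire eG_surj eX_surj) => -[n|n].
  - by have [] := FP n.
  - exact: open_stab_neq.
  - by have [] := FP n.
  - apply/dense_HomP => phi c.
    have [phiL|] := pselect (stab phi (eX n) = L); last by exists phi.
    have [K KP] := perturb_stab eG_surj eX_surj X_infinite phi c (eX n).
    (* As [L] is not isolated, the finite test set [K] cannot single it out. *)
    have [M MK ML] : exists2 M, {in K, mem_sub M =1 mem_sub L} & M <> L.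
      apply: contrapT => H; apply: nisol; apply/isolatedP; exists K => M MK.
      by apply: contrapT => ML; apply: H; exists M.
    rewrite -phiL in MK; have [psi psic psiM] := KP M MK.
    by exists psi => //=; rewrite psiM.
have [psi _ psiE] := (dense_HomP _).1 dE tau [::].
have [a _ apsi] : conj_orbit tau psi by apply: Ftau => n _; exact: (psiE (inl n)).
have [n an] := eX_surj (perm_fun a x0).
by apply: (psiE (inr n) I); rewrite an -apsi stab_conj_hom.
Qed.

Lemma solitary_of_generic : has_generic_representation G X -> solitary G.
Proof.
move=> [tau tauP]; apply/dense_SubgrpP => L K.
(* [phi] only witnesses that the open set of representations with stabilizer of [x] near [L] is
   nonempty; the comeager orbit must then meet it. *)
have [phi _ [x _ phiL]] :=
  add_orbit eG_surj eX_surj X_infinite tau [::] [::] L.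
have oU := open_stab_in K (mem_sub L) x.
have [_ [F FP ->] Ftau] := tauP.
have dF : dense (\bigcap_n F n).
  by apply: (Hom_Baire eG_surj eX_surj) => n; have [] := FP n.
have [psi [psiK psiF]] : [set phi : Hom G X | {in K, mem_sub (stab phi x) =1
    mem_sub L}] `&` \bigcap_n F n !=set0.
  by apply: dF => //; exists phi => /=; rewrite phiL.
have [a _ apsi] := Ftau _ psiF.
have [b ab ba] := perm_fun_bij a.
exists (stab psi x) => //.
by rewrite -apsi -(ba x) stab_conj_hom; exact: generic_stab_isolated.
Qed.

End Rich.
End GenericRepresentations.

Theorem theorem1p3 (G : groupType) (X : choiceType)
  (G_countable : countable [set: G])
  (X_countable : countable [set: X]) (X_infinite : infinite_set [set: X]) :
  has_generic_representation G X <-> solitary G.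
Proof.
have [x0 _] := infinite_setN0 X_infinite.
have [eG eG_surj] := nat_surjection (1%g : G) G_countable.
have [eX eX_surj] := nat_surjection x0 X_countable.
split.
- exact: (solitary_of_generic eG_surj eX_surj X_infinite).
- exact: (generic_of_solitary eG_surj eX_surj X_infinite).
Qed.
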